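(* Let $\mathcal{C}$ be a class of surjective piecewise expanding maps of $[0,1]$ that satisfies $(D_r)$ for some $r\ge1$ and for which there exist $\lambda>1$ and $C>0$ such that $\inf|T'|\ge\lambda$ and $\sup|T'|\le C$ for all $T\in\mathcal{C}$. Let $(T_n)_{n\ge1}$ be a sequential dynamical system with all $T_n\in\mathcal{C}$, and suppose that $(T_n)$ is covering. Then the condition (Min) is satisfied: there exists $\delta>0$ such that $P_1^n\mathbf{1}\ge\delta$ for all $n\ge1$.
   Context: $m$ is Lebesgue measure on $[0,1]$ with its Borel $\sigma$-algebra. A piecewise expanding map is a map $T:[0,1]\to[0,1]$ with $\inf_x|T'(x)|>1$ for which there is a finite partition $\mathcal{A}_T$ of $[0,1]$ into intervals with disjoint interiors such that $T$ can be extended to a $C^2$ map on a neighborhood of each element of $\mathcal{A}_T$. Its transfer operator $P_T:L^1(m)\to L^1(m)$ is characterized by $\int P_Tf\cdot g\,dm=\int f\cdot g\circ T\,dm$ for $f\in L^1(m)$, $g\in L^\infty(m)$; equivalently $P_Tf(x)=\sum_{Ty=x}f(y)/|T'(y)|$. Inequalities between elements of $L^1(m)$ are understood $m$-a.e. For $f\in L^1(m)$, $\mathrm{V}f$ is the infimum of the total variations on $[0,1]$ of the functions $\bar f$ with $\bar f=f$ $m$-a.e.; $\mathrm{BV}=\{f\in L^1(m):\mathrm{V}f<\infty\}$ with norm $\|f\|_{\mathrm{BV}}=\mathrm{V}f+\|f\|_{L^1_m}$. $(D_r)$: a class $\mathcal{C}$ of piecewise expanding maps satisfies $(D_r)$,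 $r\ge1$ an integer, if there are constants $0<\rho_r<1$, $M_0>0$, $C_r>0$ such that $\|P_Tf\|_{\mathrm{BV}}\le M_0\|f\|_{\mathrm{BV}}$ for all $T\in\mathcal{C}$, $f\in\mathrm{BV}$, and $\|P_{T_r}\cdots P_{T_1}f\|_{\mathrm{BV}}\le\rho_r\|f\|_{\mathrm{BV}}+C_r\|f\|_{L^1_m}$ for all $T_1,\ldots,T_r\in\mathcal{C}$, $f\in\mathrm{BV}$. For a sequence $(T_n)_{n\ge1}$ and $n\le k$: $T_n^k=T_k\circ\cdots\circ T_n$, $P_n^k=P_{T_k}\cdots P_{T_n}$. $\mathcal{A}_n^k$ denotes the partition of monotonicity of $T_n^k$, i.e. the partition of $[0,1]$ into intervals generated by $(T_n^{j-1})^{-1}(\mathcal{A}_{T_j})$, $n\le j\le k$ (with $T_n^{n-1}=\mathrm{Id}$). The system $(T_n)$ is covering if for every $n\ge 1$ there exists an integer $N(n)$ such that for all $m\ge0$ and all $I\in\mathcal{A}_{m+1}^{m+n}$ one has $T_{m+1}^{m+N(n)}(I)=[0,1]$ (here $m$ is an integer index). *)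

(* Defs.v *)
(* MathComp / MathComp-Analysis *)
From HB Require Import structures.
From mathcomp Require Import all_boot all_order all_algebra.
From mathcomp Require Import all_classical all_reals all_analysis.

Set Implicit Arguments.
Unset Strict Implicit.
Unset Printing Implicit Defensive.

Import Order.TTheory GRing.Theory Num.Theory.
Import numFieldNormedType.Exports.

Local Open Scope classical_set_scope.
Local Open Scope ring_scope.

(* The ambient space is [0, 1] inside R: maps and functions have type R -> R
   and only their restrictions to [0, 1] matter. *)
Definition I01 (R : realType) : set R := `[0, 1]%classic.
Arguments I01 {R}.

Section PiecewiseExpanding.
Variable R : realType.
Implicit Types (U I : set R) (T g : R -> R).

Definition C2_on U g : Prop := forall x, U x ->
  [/\ derivable g x 1, derivable (g^`())%classic x 1
    & {for x, continuous (g^`(2))%classic}].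

(* The neighbourhood contains the closure of I, so that a half-open I still
   carries a C^2 extension across both of its endpoints. *)
Definition C2_extendable T I : Prop := exists (U : set R) (g : R -> R),
  [/\ open U, closure I `<=` U, C2_on U g & forall x, I x -> T x = g x].

(* Elements may be open, closed, half-open or degenerate intervals: together
   with disjointness of interiors only, this leaves the value of a map at a
   break point unconstrained. *)
Definition interval_partition (A : set (set R)) : Prop :=
  [/\ finite_set A,
      forall I, A I -> is_interval I,
      \bigcup_(I in A) I = I01
    & trivIset A (@interior R)].

(* The values |T'(x)|; x ranges over the interiors of the elements of A, that
   is over [0, 1] up to finitely many points, where T' may fail to exist. *)
Definition abs_derivatives (A : set (set R)) T : set (\bar R) :=
  [set `|(T^`())%classic x|%:E | x in \bigcup_(I in A) I°].

Definition inf_derivative A T : \bar R := ereal_inf (abs_derivatives A T).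
Definition sup_derivative A T : \bar R := ereal_sup (abs_derivatives A T).

End PiecewiseExpanding.

Record pexp_map (R : realType) := PExpMap {
  pexp_fun :> R -> R;
  pexp_part : set (set R);
  pexp_stable : pexp_fun @` I01 `<=` I01;
  pexp_partP : interval_partition pexp_part;
  pexp_C2 : forall I, pexp_part I -> C2_extendable pexp_fun I;
  pexp_expanding : (1 < inf_derivative pexp_part pexp_fun)%E
}.

Section Operators.
Variable R : realType.
Local Notation m := (@lebesgue_measure R).
Implicit Types (T : pexp_map R) (f g h : R -> R).

Definition in_L1 f : Prop := m.-integrable I01 (EFin \o f).

Definition in_Linfty h : Prop := measurable_fun I01 h /\
  exists M : R, {ae m, forall x, I01 x -> `|h x| <= M}.

Definition L1norm f : \bar R := (\int[m]_(x in I01) `|f x|%:E)%E.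

Definition var f : \bar R := ereal_inf
  [set total_variation 0 1 fbar | fbar in
    [set fbar : R -> R | {ae m, forall x, I01 x -> fbar x = f x}]].

Definition in_BV f : Prop := in_L1 f /\ (var f < +oo)%E.

Definition BVnorm f : \bar R := (var f + L1norm f)%E.

Definition is_transfer T f g : Prop := in_L1 g /\
  forall h, in_Linfty h ->
    (\int[m]_(x in I01) (g x * h x)%:E =
     \int[m]_(x in I01) (f x * h (T x))%:E)%E.

(* A representative of P_T f in L^1(m). For f in L^1(m) it exists and is unique
   almost everywhere; the default value 0 is only used outside L^1(m). *)
Definition transfer T f : R -> R := xget (cst 0) [set g | is_transfer T f g].

(* T_n^k = T_k o ... o T_n, which is the identity for k = n - 1. *)
Definition seq_map (T : nat -> pexp_map R) (n k : nat) (x : R) : R :=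
  foldl (fun y j => T j y) x (index_iota n k.+1).

(* P_n^k = P_{T_k} ... P_{T_n} *)
Definition seq_transfer (T : nat -> pexp_map R) (n k : nat) (f : R -> R) :
    R -> R :=
  foldl (fun g j => transfer (T j) g) f (index_iota n k.+1).

(* The partition A_n^k, for n >= 1. Intersections with empty interior (empty
   sets and isolated points) are not elements of the partition. *)
Definition seq_partition (T : nat -> pexp_map R) (n k : nat) : set (set R) :=
  [set I | I° !=set0 /\ exists J : nat -> set R,
    (forall j, (n <= j <= k)%N -> pexp_part (T j) (J j)) /\
    I = I01 `&`
        \bigcap_(j in [set j | (n <= j <= k)%N]) (seq_map T n j.-1 @^-1` J j)].

Definition covering (T : nat -> pexp_map R) : Prop :=
  forall n : nat, (1 <= n)%N -> exists N : nat,
    forall (p : nat) (I : set R), seq_partition T p.+1 (p + n) I ->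
      seq_map T p.+1 (p + N) @` I = I01.

Definition cond_D (r : nat) (C : set (pexp_map R)) : Prop :=
  exists rho M0 Cr : R,
    [/\ 0 < rho < 1, 0 < M0, 0 < Cr,
        forall T f, C T -> in_BV f ->
          (BVnorm (transfer T f) <= M0%:E * BVnorm f)%E
      & forall (T : nat -> pexp_map R) f,
          (forall i, (1 <= i <= r)%N -> C (T i)) -> in_BV f ->
          (BVnorm (seq_transfer T 1 r f)
             <= rho%:E * BVnorm f + Cr%:E * L1norm f)%E].

Definition cond_Min (T : nat -> pexp_map R) : Prop :=
  exists2 delta : R, 0 < delta & forall n : nat, (1 <= n)%N ->
    {ae m, forall x, I01 x -> delta <= seq_transfer T 1 n (cst 1) x}.

End Operators.

(* Main.v *)
(* Every f_m := P_1^m 1 is nonnegative with integral 1, and iterating (D_r)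
   bounds its BV norm independently of m. Cut [0, 1] into cells of a fixed length
   h. If f_m were somewhere below 1/2 on every cell, then f_m <= 1/2 + V(f_m) on
   each cell, V being the variation over that cell, and summing would give an
   integral at most 1/2 + h V(f_m) < 1. Hence f_m >= 1/2 on a whole cell. The
   elements of A_{m+1}^{m+n} have diameter at most lambda^-n, so for n fixed large
   enough one of them, I, lies in that cell. By covering T_{m+1}^{m+N} maps I
   onto [0, 1] for some N not depending on m; as this map multiplies measures by at
   most K^N, duality gives f_{m+N} >= K^-N / 2. The first N functions are
   bounded below by K^-n because the maps are surjective. *)
Require Import Defs.
From HB Require Import structures.
From mathcomp Require Import all_boot all_order all_algebra.
From mathcomp Require Import all_classical all_reals all_analysis.
From mathcomp Require Import measurable_realfun lra.

Set Implicit Arguments.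
Unset Strict Implicit.
Unset Printing Implicit Defensive.

Import Order.TTheory GRing.Theory Num.Theory.
Import numFieldNormedType.Exports.

Local Open Scope classical_set_scope.
Local Open Scope ring_scope.

(** * Lebesgue outer measure *)

(* Convertible to [lebesgue_measure], but may be applied to non-measurable sets,
   such as images under a piecewise C^2 map. *)
Local Notation outer := (mu_ext (@wlength _ idfun)).

Section OuterMeasure.
Context {R : realType}.
Implicit Types (A : set R) (d L : R).

(** A nonempty [A] lies between its infimum and its supremum, which are at most [d] apart. This
    converts distance estimates on a branch into measure estimates. *)
Lemma outer_diam A d : 0 <= d ->
  (forall x y, A x -> A y -> `|x - y| <= d) -> (outer A <= d%:E)%E.
Proof.
move=> d0 dA; have [->|/set0P[x0 Ax0]] := eqVneq A set0.
  by rewrite outer_measure0 lee_fin.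
have uA : has_ubound A.
  by exists (x0 + d) => y Ay; have := dA _ _ Ay Ax0; rewrite ler_norml; lra.
have lA : has_lbound A.
  by exists (x0 - d) => y Ay; have := dA _ _ Ay Ax0; rewrite ler_norml; lra.
have AI : A `<=` `[inf A, sup A].
  by move=> y Ay; rewrite /= in_itv/= ge_inf//= ub_le_sup.
apply: (le_trans (le_outer_measure outer _ _ AI)).
rewrite -[leLHS]/(lebesgue_measure `[inf A, sup A]%classic).
rewrite lebesgue_measure_itv/=; case: ifPn => _; last by rewrite lee_fin.
rewrite -EFinB lee_fin lerBlDr -lerBlDl.
apply: lb_le_inf; first by exists x0.
move=> y Ay; rewrite lerBlDl; apply: ge_sup; first by exists x0.
by move=> z Az; have := dA _ _ Az Ay; rewrite ler_norml; lra.
Qed.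

(* A relation [r] covers both images and preimages under a map. *)
Lemma outer_transport (r : R -> R -> Prop) L : 0 < L ->
  (forall a b, a < b ->
    (outer [set y | exists2 x, `]a, b]%classic x & r x y] <= (L * (b - a))%:E)%E) ->
  forall A, (outer [set y | exists2 x, A x & r x y] <= L%:E * outer A)%E.
Proof.
(* After division by [L] the goal bounds from below an infimum over countable covers by half-open
   intervals; [r] carries a cover of [A] to a cover of the related set. *)
move=> L0 rL A; rewrite muleC -lee_pdivrMr//.
apply: le_ereal_inf_tmp => _ [F [mF AF] <-].
rewrite lee_pdivrMr// muleC -nneseriesZl; last by move=> i _; exact: wlength_ge0.
have AF' : [set y | exists2 x, A x & r x y] `<=`
    \bigcup_i [set y | exists2 x, F i x & r x y].
  by move=> y [x /AF[i _ Fix] rxy]; exists i => //; exists x.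
apply: (le_trans (le_outer_measure outer _ _ AF')).
apply: (le_trans (outer_measure_sigma_subadditive _ _)).
apply: lee_nneseries => [i _ _|i _]; first exact: outer_measure_ge0.
have /ocitvP[->|[[a b] ab ->]] := mF i.
  rewrite wlength0 mule0 (_ : [set y | _] = set0) ?outer_measure0//.
  by apply/seteqP; split => // y [].
by rewrite wlength_itv/= lte_fin ab -EFinB -EFinM; exact: rL.
Qed.

End OuterMeasure.

(** * Branches of a piecewise expanding map *)

Section Branches.
Context {R : realType}.
Implicit Types (T : pexp_map R) (J : set R) (x y : R).

Lemma interval_interior J x y : is_interval J -> J x -> J y ->
  `]x, y[ `<=` J°.
Proof.
move=> iJ Jx Jy; rewrite -open_subsetE; last exact: interval_open.
move=> z /=; rewrite in_itv/= => /andP[xz zy].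
by apply: (iJ _ _ Jx Jy); rewrite !ltW.
Qed.

Lemma part_interval T J : pexp_part T J -> is_interval J.
Proof. by case: (pexp_partP T) => _ + _ _; exact. Qed.

Lemma part_finite T : finite_set (pexp_part T).
Proof. by case: (pexp_partP T). Qed.

Lemma part_cover T : \bigcup_(J in pexp_part T) J = I01.
Proof. by case: (pexp_partP T). Qed.

Lemma C2_on_derivable (U : set R) (g : R -> R) x :
  C2_on U g -> U x -> derivable g x 1.
Proof. by move=> gC2 /gC2[+ _ _]; exact. Qed.

(** Near an interior point [T] coincides with the extension [g]; at an end of [J] it need not. *)
Lemma part_continuous T J x : pexp_part T J -> J° x -> {for x, continuous T}.
Proof.
move=> TJ Jx; have [U [g [_ JU gC2 Tg]]] := pexp_C2 TJ.
have gx : {for x, continuous g}.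
  apply: differentiable_continuous; apply/derivable1_diffP.
  by apply: C2_on_derivable gC2 _; apply/JU/subset_closure/(interior_subset Jx).
have Tgx : T x = g x by exact: Tg _ (interior_subset Jx).
have gT : \near x, g x = T x by apply: filterS Jx => z /Tg ->.
rewrite /prop_for /continuous_at Tgx.
exact: cvg_trans (near_eq_cvg gT) gx.
Qed.

Lemma part_measurable T J : pexp_part T J -> measurable_fun J T.
Proof.
move=> TJ; have [U [g [oU JU gC2 Tg]]] := pexp_C2 TJ.
apply: (eq_measurable_fun g) => [x|]; first by rewrite inE => /Tg ->.
apply: (@measurable_funS _ _ _ _ U); first exact: open_measurable.
  exact: subset_trans (subset_closure (A := J)) JU.
apply: open_continuous_measurable_fun => // x; rewrite inE => Ux.
apply: differentiable_continuous; apply/derivable1_diffP.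
exact: C2_on_derivable gC2 Ux.
Qed.

Lemma measurable_fun_pexp T : measurable_fun I01 T.
Proof.
move=> _ Y mY; rewrite -(part_cover T) setI_bigcupl.
apply: fin_bigcup_measurable; first exact: part_finite.
move=> J TJ; apply: (part_measurable TJ) => //.
by apply: is_interval_measurable; exact: part_interval TJ.
Qed.

(** The mean value theorem is applied to the extension [g]. The intermediate point lies strictly
    between [x] and [y], hence in the interior of [J], where [T] and [g] agree locally and where the
    bounds on the derivative are available. *)
Lemma part_MVT T J x y : pexp_part T J -> J x -> J y -> x < y ->
  exists2 c, J° c & T y - T x = (T^`())%classic c * (y - x).
Proof.
move=> TJ Jx Jy xy; have [U [g [oU JU gC2 Tg]]] := pexp_C2 TJ.
have xyJ : `[x, y]%classic `<=` J.
  by move=> z /=; rewrite in_itv/=; exact: part_interval TJ _ _ Jx Jy z.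
have dg z : z \in `[x, y] -> derivable g z 1.
  move=> zxy; apply: C2_on_derivable gC2 _; exact/JU/subset_closure/xyJ.
have [c cxy gE] : exists2 c, c \in `]x, y[ &
    g y - g x = (g^`())%classic c * (y - x).
  apply: MVT => // [z zxy|]; last exact: derivable_within_continuous.
  by rewrite derive1E; apply/derivableP/dg/subset_itv_oo_cc.
have Jc : J° c by apply: interval_interior cxy => //; exact: part_interval TJ.
exists c => //; rewrite !Tg// gE; congr (_ * _).
rewrite !derive1E; apply: near_eq_derive.
by apply: filterS Jc => z /Tg ->.
Qed.

Lemma part_expand T J x y (lam : R) : (lam%:E <= inf_derivative (pexp_part T) T)%E ->
  pexp_part T J -> J x -> J y -> lam * `|x - y| <= `|T x - T y|.
Proof.
move=> lamT TJ.
wlog xy : x y / x <= y.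
  by move=> H Jx Jy; have [?|/ltW yx] := leP x y; [|rewrite distrC (distrC (T x))]; exact: H.
move: xy; rewrite le_eqVlt => /predU1P[->|xy] Jx Jy; first by rewrite !subrr normr0 mulr0.
have [c Jc TE] := part_MVT TJ Jx Jy xy.
rewrite (distrC x) (distrC (T x)) TE normrM ler_wpM2r// -lee_fin.
apply: (le_trans lamT); apply: ereal_inf_lbound; exists c => //.
by exists J.
Qed.

Lemma part_lipschitz T J x y (K : R) : (sup_derivative (pexp_part T) T <= K%:E)%E ->
  pexp_part T J -> J x -> J y -> `|T x - T y| <= K * `|x - y|.
Proof.
move=> TK TJ.
wlog xy : x y / x <= y.
  by move=> H Jx Jy; have [?|/ltW yx] := leP x y; [|rewrite distrC (distrC x)]; exact: H.
move: xy; rewrite le_eqVlt => /predU1P[->|xy] Jx Jy; first by rewrite !subrr normr0 mulr0.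
have [c Jc TE] := part_MVT TJ Jx Jy xy.
rewrite (distrC x) (distrC (T x)) TE normrM ler_wpM2r// -lee_fin.
apply: le_trans TK; apply: ereal_sup_ubound; exists c => //.
by exists J.
Qed.

End Branches.

(** * Null sets and measures of images under one map *)

Section Nonsingularity.
Context {R : realType}.
Local Notation mu := (@lebesgue_measure R).
Implicit Types (T : pexp_map R) (J : set R).

(** Padding with [set0] gives a sequence suited to countable subadditivity; removing duplicates
    makes distinct indices stand for distinct elements, so that the interiors are disjoint. *)
Lemma part_enum T : exists F : nat -> set R,
  [/\ forall i, pexp_part T (F i) \/ F i = set0,
      \bigcup_i F i = I01 & trivIset setT (fun i => (F i)°)].
Proof.
have [+ _ cov tA] := pexp_partP T; move=> /finite_seqP[s sA].
have mem_nth i : (i < size (undup s))%N -> pexp_part T (nth set0 (undup s) i).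
  by move=> si; rewrite sA/= -mem_undup mem_nth.
exists (nth set0 (undup s)); split.
- by move=> i; have [/mem_nth|/(nth_default set0)] := ltnP i (size (undup s)); [left|right].
- rewrite -cov; apply/seteqP; split=> x [i].
  + move=> _ ix; exists (nth set0 (undup s) i) => //.
    by apply: mem_nth; rewrite ltnNge; apply/negP => /(nth_default set0) i0; rewrite i0 in ix.
  + rewrite sA/= -mem_undup => si ix; exists (index i (undup s)) => //.
    by rewrite nth_index.
- move=> i j _ _ ij.
  have lt_size k x : (nth set0 (undup s) k)° x -> (k < size (undup s))%N.
    move=> kx; rewrite ltnNge; apply/negP => /(nth_default set0) k0.
    by rewrite k0 interior0 in kx.
  have [x [ix jx]] := ij; have si := lt_size _ _ ix; have sj := lt_size _ _ jx.
  apply/eqP; rewrite -(nth_uniq set0 si sj (undup_uniq s)); apply/eqP.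
  by apply: tA ij; exact: mem_nth.
Qed.

Lemma expanding_ge1 T J x y : pexp_part T J -> J x -> J y ->
  `|x - y| <= `|T x - T y|.
Proof.
move=> TJ Jx Jy; rewrite -[leLHS]mul1r.
exact: part_expand (ltW (pexp_expanding T)) TJ Jx Jy.
Qed.

(** Inverse branches do not increase distances, so within one element the preimage of an interval
    has diameter at most the length of that interval. *)
Lemma pexp_nonsingular T (N : set R) : outer N = 0%E ->
  outer (I01 `&` T @^-1` N) = 0%E.
Proof.
move=> N0; have [F [FT FI _]] := part_enum T.
apply/eqP; rewrite eq_le outer_measure_ge0 andbT.
rewrite -FI setI_bigcupl.
apply: (le_trans (outer_measure_sigma_subadditive _ _)).
rewrite eseries0// => i _ _; apply/eqP; rewrite eq_le outer_measure_ge0 andbT.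
have [TJ|->] := FT i; last by rewrite set0I outer_measure0.
rewrite -[leRHS](mule0 1%E) -N0.
pose r x y := F i y /\ T y = x.
rewrite [X in (outer X <= _)%E](_ : _ = [set y | exists2 x, N x & r x y]); last first.
  by apply/seteqP; split=> y; [move=> [? ?]; exists (T y)|move=> [x Nx [? e]]; split=> //=; rewrite e].
apply: outer_transport => // a b ab; rewrite mul1r.
apply: outer_diam; first by rewrite subr_ge0 ltW.
move=> x y [x' + [Jx ex]] [y' + [Jy ey]]; rewrite /= !in_itv/= -ex -ey.
move=> Tx Ty; apply: (le_trans (expanding_ge1 TJ Jx Jy)).
rewrite ler_norml; lra.
Qed.

(** An interval is cut along the elements of the partition. Each piece has an image of diameter at
    most [K] times the measure of its trace on the interior of the element, and these traces add up
    to at most the length of the interval. *)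
Lemma outer_image T (K : R) : 0 < K ->
  (sup_derivative (pexp_part T) T <= K%:E)%E ->
  forall E, E `<=` I01 -> (outer (T @` E) <= K%:E * outer E)%E.
Proof.
move=> K0 TK E EI.
pose r x y := I01 x /\ T x = y.
rewrite [X in (outer X <= _)%E](_ : _ = [set y | exists2 x, E x & r x y]); last first.
  apply/seteqP; split=> y [x Ex]; first by move=> <-; exists x => //; split=> //; exact: EI.
  by move=> [_ <-]; exists x.
apply: outer_transport => // a b ab.
have [F [FT FI tF]] := part_enum T.
have sub : [set y | exists2 x, `]a, b]%classic x & r x y] `<=`
    \bigcup_i T @` (`]a, b]%classic `&` F i).
  by move=> y [x xab []]; rewrite -FI => -[i _ ix] <-; exists i => //; exists x.
apply: (le_trans (le_outer_measure outer _ _ sub)).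
apply: (le_trans (outer_measure_sigma_subadditive _ _)).
have mF i : measurable (`]a, b]%classic `&` (F i)°).
  by apply: measurableI => //; apply: open_measurable; exact: open_interior.
(* The open segment between two points of a piece lies in the interior of [F i]. Interiors are used
   because only they are known to be disjoint. *)
have bd i : (outer (T @` (`]a, b]%classic `&` F i)) <=
    K%:E * mu (`]a, b]%classic `&` (F i)°))%E.
  have [TJ|->] := FT i; last first.
    by rewrite setI0 image_set0 outer_measure0 mule_ge0// lee_fin ltW.
  have fin : mu (`]a, b]%classic `&` (F i)°) \is a fin_num.
    rewrite ge0_fin_numE//; apply: (@le_lt_trans _ _ (mu `]a, b]%classic)).
      by apply: le_measure; rewrite ?inE//; exact: mF.
    by rewrite lebesgue_measure_itv/= lte_fin ab -EFinB ltry.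
  rewrite -(fineK fin) -EFinM; apply: outer_diam.
    by rewrite mulr_ge0 ?fine_ge0// ltW.
  move=> _ _ [x [xab Jx] <-] [y [yab Jy] <-].
  apply: (le_trans (part_lipschitz TK TJ Jx Jy)).
  rewrite ler_wpM2l ?(ltW K0)//.
  wlog xy : x y xab yab Jx Jy / x < y.
    move=> H; have [xy|xy|->] := ltgtP x y; first exact: H.
      by rewrite distrC; exact: H.
    by rewrite subrr normr0 fine_ge0.
  rewrite distrC gtr0_norm ?subr_gt0// -lee_fin fineK//.
  apply: (@le_trans _ _ (mu `]x, y[%classic)).
    by rewrite lebesgue_measure_itv/= lte_fin xy -EFinB.
  apply: le_measure; rewrite ?inE//; first exact: mF.
  move=> z zxy; split.
    by move: xab yab zxy; rewrite /= !in_itv/=; lra.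
  exact: interval_interior (part_interval TJ) Jx Jy z zxy.
apply: (@le_trans _ _ (\sum_(i <oo) K%:E * mu (`]a, b]%classic `&` (F i)°))%E).
  by apply: lee_nneseries => [i _ _|i _]; [exact: outer_measure_ge0|exact: bd].
rewrite nneseriesZl// EFinM lee_wpmul2l ?lee_fin ?(ltW K0)//.
rewrite -measure_semi_bigcup; [|exact: mF|exact: trivIset_setIl|exact: bigcupT_measurable].
apply: (@le_trans _ _ (mu `]a, b]%classic)); last first.
  by rewrite lebesgue_measure_itv/= lte_fin ab -EFinB.
apply: le_measure; rewrite ?inE//; first by apply: bigcup_measurable => i _; exact: mF.
by move=> x [i _ []].
Qed.

End Nonsingularity.

(** * Transfer operators *)

Section TransferMeasure.
Local Open Scope ereal_scope.
Context d (X : measurableType d) {R : realType}.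

(** The push-forward by [S] of the measure with density [F]. The proofs are arguments so that the
    finite measure structure can be inferred from the term. *)
Definition transfer_measure (mu : {measure set X -> \bar R}) (F : X -> \bar R)
    (S : X -> X) of (forall x, 0 <= F x) & mu.-integrable setT F
    & measurable_fun setT S : set X -> \bar R :=
  fun A => \int[mu]_(x in S @^-1` A) F x.

Section Instances.
Variables (mu : {measure set X -> \bar R}) (F : X -> \bar R) (S : X -> X).
Hypotheses (F0 : forall x, 0 <= F x) (intF : mu.-integrable setT F).
Hypothesis mS : measurable_fun setT S.
Local Notation nu := (transfer_measure F0 intF mS).

Let mpre A : measurable A -> measurable (S @^-1` A).
Proof. by move=> mA; rewrite -[X in measurable X]setTI; exact: mS. Qed.

Let nu_set0 : nu set0 = 0.
Proof. by rewrite /transfer_measure preimage_set0 integral_set0. Qed.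

Let nu_ge0 A : 0 <= nu A. Proof. exact: integral_ge0. Qed.

Let nu_sigma_additive : semi_sigma_additive nu.
Proof.
move=> A mA tA mUA; rewrite /transfer_measure preimage_bigcup.
apply: (semi_sigma_additive_nng_induced (measurable_int _ intF) F0).
- by move=> n; exact: mpre.
- apply/trivIsetP => /= i j _ _ ij; rewrite -preimage_setI.
  by move/trivIsetP : tA => /(_ _ _ _ _ ij) ->//; rewrite preimage_set0.
- by rewrite -preimage_bigcup; exact: mpre.
Qed.

HB.instance Definition _ :=
  isMeasure.Build _ _ _ nu nu_set0 nu_ge0 nu_sigma_additive.

Let nu_fin : fin_num_fun nu.
Proof.
move=> A mA; apply: integrable_fin_num; first exact: mpre.
by apply: integrableS intF => //; exact: mpre.
Qed.

HB.instance Definition _ := Measure_isFinite.Build _ _ _ nu nu_fin.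

End Instances.

Lemma ae_bounded_integrable (nu : {finite_measure set X -> \bar R})
    (h : X -> R) (M : R) : measurable_fun setT h ->
  {ae nu, forall x, (`|h x| <= M)%R} -> nu.-integrable setT (EFin \o h).
Proof.
move=> mh hM; apply/integrableP; split; first exact/measurable_EFinP.
apply: le_lt_trans.
  apply: (@integral_le_bound _ _ _ _ _ _ `|M|%:E) => //.
  - exact/measurable_EFinP.
  - by apply: filterS hM => x hM _; rewrite lee_fin (le_trans hM)// ler_norm.
by rewrite lte_mul_pinfty// fin_num_fun_lty//; exact: fin_num_measure.
Qed.

(** The hypothesis on null sets is absolute continuity of the push-forward, and [g] is its
    Radon-Nikodym derivative. *)
Lemma transfer_density (mu : {sigma_finite_measure set X -> \bar R})
    (F : X -> \bar R) (S : X -> X) :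
  (forall x, 0 <= F x) -> mu.-integrable setT F -> measurable_fun setT S ->
  (forall A, measurable A -> mu A = 0 -> \int[mu]_(x in S @^-1` A) F x = 0) ->
  exists2 g : X -> R, mu.-integrable setT (EFin \o g) &
    forall (h : X -> R) (M : R), measurable_fun setT h ->
      {ae mu, forall x, (`|h x| <= M)%R} ->
      \int[mu]_x (g x * h x)%:E = \int[mu]_x ((h (S x))%:E * F x).
Proof.
(* [nu] is the push-forward by [S] of [nu1], the measure with density [F]; the
   change of variables is applied to both. *)
move=> F0 intF mS numu.
have mpre A : measurable A -> measurable (S @^-1` A).
  by move=> mA; rewrite -[X in measurable X]setTI; exact: mS.
pose nu : {finite_measure set X -> \bar R} := transfer_measure F0 intF mS.
pose nu1 : {finite_measure set X -> \bar R} :=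
  transfer_measure F0 intF (@measurable_id _ _ setT).
have dnu : nu `<< mu by apply/null_content_dominatesP => A mA A0; exact: numu.
have dnu1 : nu1 `<< mu.
  apply/null_content_dominatesP => A mA A0; apply: null_set_integral => //.
  exact/measurable_funTS/(measurable_int _ intF).
pose g := Radon_Nikodym (charge_of_finite_measure nu) mu.
have gfin x : g x \is a fin_num by exact: Radon_Nikodym_fin_num.
exists (fine \o g).
  rewrite (_ : EFin \o _ = g); last by apply/funext => x /=; rewrite fineK.
  exact: Radon_Nikodym_integrable.
move=> h M mh hM.
have nuh : {ae nu, forall x, (`|h x| <= M)%R}.
  case: hM => A [mA A0 hA]; exists A; split => //.
  exact: numu.
transitivity (\int[mu]_x ((EFin \o h) x * g x)).
  by apply: eq_integral => x _; rewrite /= EFinM fineK// muleC.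
rewrite Radon_Nikodym_change_of_variables//; last exact: ae_bounded_integrable nuh.
have int1 : nu1.-integrable setT ((EFin \o h) \o S).
  apply: (@ae_bounded_integrable _ (h \o S) M); first exact: measurableT_comp.
  case: nuh => A [mA A0 hA]; exists (S @^-1` A); split => //.
    exact: mpre.
  by move=> x /= hx; apply: hA.
transitivity (\int[nu1]_x ((EFin \o h) \o S) x).
  rewrite -[RHS](@integral_pushforward _ _ _ _ _ S mS nu1 setT (EFin \o h))//.
  exact/measurable_EFinP.
rewrite -(Radon_Nikodym_change_of_variables dnu1 measurableT int1).
apply: ae_eq_integral => //.
- apply: emeasurable_funM; first exact/measurable_EFinP/measurableT_comp.
  by apply: measurable_int; exact: Radon_Nikodym_integrable.
- apply: emeasurable_funM; first exact/measurable_EFinP/measurableT_comp.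
  exact: (measurable_int _ intF).
(* The derivative of [nu1] is [F] almost everywhere, both having the same integral over every
   measurable set. *)
- apply: ae_eqe_mul2l; apply: integral_ae_eq => //.
  + exact: Radon_Nikodym_integrable.
  + exact: (measurable_int _ intF).
  + move=> A _ mA; rewrite -Radon_Nikodym_integral//.
Qed.

End TransferMeasure.

Section Transfer.
Context {R : realType}.
Local Notation mu := (@lebesgue_measure R).
Implicit Types (T : pexp_map R) (f g h : R -> R).

Lemma measurable_I01 : measurable (I01 : set R).
Proof. exact: measurable_itv. Qed.

Lemma lebesgue_measure_I01 : mu I01 = 1%E.
Proof. by rewrite /I01 lebesgue_measure_itv/= lte_fin ltr01 oppr0 adde0. Qed.

Lemma lebesgue_aeS (P Q : R -> Prop) : (forall x, P x -> Q x) ->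
  {ae mu, forall x, P x} -> {ae mu, forall x, Q x}.
Proof. by move=> PQ; apply: filterS PQ; exact: (ae_filter_ringOfSetsType mu). Qed.

Lemma L1_measurable f : in_L1 f -> measurable_fun I01 f.
Proof. by move=> f1; apply/measurable_EFinP; exact: (measurable_int _ f1). Qed.

(** By nonsingularity the exceptional set of the bound on [h] pulls back to a null set. Test
    functions can thus be moved through one map at a time. *)
Lemma Linfty_comp T h : in_Linfty h -> in_Linfty (h \o T).
Proof.
move=> [mh [M [A [mA A0 hA]]]]; split.
  apply: (measurable_comp measurable_I01 _ mh); last exact: measurable_fun_pexp.
  exact: pexp_stable.
exists M.
have TA0 : mu.-negligible (I01 `&` T @^-1` A).
  by apply/negligible_outer_measure/pexp_nonsingular.
apply: negligibleS TA0 => x /= /not_implyP[Ix hx]; split => //.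
by apply: hA => /(_ (pexp_stable _)) H; apply/hx/H; exists x.
Qed.

(** Existence of a transfer makes the choice in [transfer] genuine. Nonnegative functions suffice
    below, where everything starts from the constant 1. *)
Lemma transferP T f : in_L1 f -> {ae mu, forall x, I01 x -> 0 <= f x} ->
  is_transfer T f (transfer T f).
Proof.
move=> f1 f0; apply: (@xgetPex _ _ [set g | is_transfer T f g]).
have mI : measurable (I01 : set (measurableTypeR R)) by exact: measurable_I01.
(* A density must be nonnegative everywhere, hence the positive part; extension by zero moves the
   integrals to the whole line and makes the values of [S] off [I01] immaterial. *)
pose F := ((EFin \o f)^\+ \_ I01)%E.
pose S : R -> R := T \_ I01.
have intF : mu.-integrable setT F.
  rewrite /F -(integrable_mkcond _ mI); exact: integrable_funepos.
have F0 x : (0 <= F x)%E by rewrite /F patchE; case: ifP.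
have mS : measurable_fun setT S.
  apply/(measurable_restrictT _ mI); exact: measurable_fun_pexp.
have SE x : I01 x -> S x = T x by move=> Ix; rewrite /S patchE mem_set.
have mpre A : measurable A -> measurable (S @^-1` A).
  by move=> mA; rewrite -[X in measurable X]setTI; exact: mS.
have STE A : S @^-1` A `&` I01 = I01 `&` T @^-1` A.
  by apply/seteqP; split=> x /= [Ax Bx]; split=> //; [rewrite -SE|rewrite SE].
have null A : measurable A -> mu A = 0%E -> (\int[mu]_(x in S @^-1` A) F x = 0)%E.
  move=> mA A0; rewrite /F -integral_mkcondr; apply: null_set_integral.
  - by apply: measurableI => //; exact: mpre.
  - apply: (measurable_funS mI); first exact: subIsetr.
    by apply: measurable_funepos; exact: (measurable_int _ f1).
  - rewrite STE; exact: pexp_nonsingular.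
have [g intg gE] := @transfer_density _ (measurableTypeR R) R mu F S F0 intF mS null.
exists g; split; first exact: integrableS intg.
move=> h /[dup] hoo [mh [M hM]].
pose h' := h \_ I01.
have mh' : measurable_fun setT h' by apply/(measurable_restrictT _ mI).
have hM' : {ae mu, forall x, `|h' x| <= `|M|}.
  apply: lebesgue_aeS hM => x; rewrite /h' patchE; case: ifPn => [/set_mem Ix hM|_ _].
    by rewrite (le_trans (hM Ix))// ler_norm.
  by rewrite normr0.
transitivity (\int[mu]_x (g x * h' x)%:E)%E.
  rewrite integral_mkcond; apply: eq_integral => x _.
  by rewrite /h' !patchE; case: ifP => //; rewrite mulr0.
rewrite (gE _ _ mh' hM') [RHS]integral_mkcond.
have fh : measurable_fun I01 (fun x => (f x * h (T x))%:E).
  apply/measurable_EFinP/measurable_funM; first exact: L1_measurable.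
  exact: (Linfty_comp T hoo).1.
apply: ae_eq_integral => //.
- apply: emeasurable_funM; last exact: (measurable_int _ intF).
  by apply/measurable_EFinP; exact: (measurableT_comp mh' mS).
- by apply/(measurable_restrictT _ mI); exact: fh.
- apply: lebesgue_aeS f0 => x fx _; rewrite /F !patchE.
  case: ifPn => [/set_mem Ix|]; last by rewrite mule0.
  rewrite SE// /h' patchE mem_set; last by apply: pexp_stable; exists x.
  by rewrite funeposE /= max_l ?lee_fin ?fx// -EFinM mulrC.
Qed.

End Transfer.

(** * Pointwise lower bounds obtained by duality *)

Section Duality.
Context {R : realType}.
Local Notation mu := (@lebesgue_measure R).
(* [lebesgue_measure] lives on [measurableTypeR R]: its measurable structure is
   convertible to that of [R], but canonical inference does not see this. *)
Local Notation Rm := (measurableTypeR R).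
Implicit Types (T : nat -> pexp_map R) (f g h S : R -> R) (A B I : set R).

(* [is_transfer T f g] is convertible to [transfers T f g]; a general [S] is needed
   for compositions of the [T j]. *)
Definition transfers S f g : Prop := in_L1 g /\
  forall h, in_Linfty h ->
    (\int[mu]_(x in I01) (g x * h x)%:E =
     \int[mu]_(x in I01) (f x * h (S x))%:E)%E.

(** On the set [B] where [g < c] the positive function [c - g] has integral at most 0, so [B] is
    null. *)
Lemma ae_ge_of_integral g (c : R) : in_L1 g ->
  (forall B, measurable B -> B `<=` I01 ->
    (c%:E * mu B <= \int[mu]_(x in B) (g x)%:E)%E) ->
  {ae mu, forall x, I01 x -> c <= g x}.
Proof.
move=> g1 gc; have mg := L1_measurable g1.
pose B : set R := I01 `&` [set x | g x < c].
have mB : measurable (B : set Rm).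
  rewrite /B; have := mg measurable_I01 _ (measurable_itv `]-oo, c[).
  by congr measurable; apply/seteqP; split=> x /=; rewrite in_itv/=.
have BI : B `<=` I01 by exact: subIsetl.
have muB : (mu B < +oo)%E.
  apply: (@le_lt_trans _ _ (mu I01)); last by rewrite lebesgue_measure_I01 ltry.
  by apply: le_measure; rewrite ?inE//; exact: measurable_I01.
have gB : mu.-integrable B (EFin \o g) by apply: integrableS g1 => //; exact: measurable_I01.
have cB : mu.-integrable B (EFin \o cst c).
  apply: measurable_bounded_integrable => //.
  exact: bounded_cst.
have kB : mu.-integrable B (fun x => (c%:E - (g x)%:E)%E) by exact: integrableB.
have int0 : (\int[mu]_(x in B) `|c%:E - (g x)%:E| = 0)%E.
  apply/eqP; rewrite eq_le integral_ge0// andbT.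
  have -> : (\int[mu]_(x in B) `|c%:E - (g x)%:E| =
      \int[mu]_(x in B) (c%:E - (g x)%:E))%E.
    apply: eq_integral => x /set_mem[_ gxc]; rewrite gee0_abs// -EFinB lee_fin subr_ge0.
    exact: ltW.
  rewrite integralB// integral_cst// sube_le0.
  exact: gc.
have := (ae_eq_integral_abs _ mB (measurable_int _ kB)).1 int0.
apply: lebesgue_aeS => x kx Ix; rewrite leNgt; apply/negP => gxc.
have [] := kx (conj Ix gxc).
by move/eqP; rewrite subr_eq0 gt_eqF.
Qed.

Lemma Linfty_indic B : measurable B -> in_Linfty (\1_B : R -> R).
Proof.
move=> mB; split; first exact: measurable_indic.
exists 1; apply: aeW => x _; rewrite indicE; case: (_ \in _) => /=.
  by rewrite normr1.
by rewrite normr0 ler01.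
Qed.

(** Testing with the indicator of [B] turns the integral of [g] over [B] into that of [f] over the
    preimage of [B], which is at least [c] times the measure of the part inside [I]. *)
Lemma transfers_ge S f g I (c e : R) :
  measurable_fun I01 S -> in_L1 f -> transfers S f g ->
  {ae mu, forall x, I01 x -> 0 <= f x} ->
  measurable I -> I `<=` I01 -> 0 <= c ->
  {ae mu, forall x, I x -> c <= f x} ->
  (forall B, measurable B -> B `<=` I01 ->
    (e%:E * mu B <= mu (I `&` S @^-1` B))%E) ->
  {ae mu, forall x, I01 x -> c * e <= g x}.
Proof.
move=> mS f1 [g1 gE] f0 mI II c0 fc muI.
have mI01 : measurable (I01 : set Rm) by exact: measurable_I01.
apply: ae_ge_of_integral => // B mB BI.
have mIB : measurable (I `&` S @^-1` B : set Rm).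
  rewrite (_ : _ `&` _ = I `&` (I01 `&` S @^-1` B)).
    by apply: measurableI => //; apply: mS => //; exact: measurable_I01.
  by apply/seteqP; split=> x [Ix Bx]; split => //; [split=> //; exact: II|case: Bx].
have -> : (\int[mu]_(x in B) (g x)%:E =
    \int[mu]_(x in I01) (f x * \1_B (S x))%:E)%E.
  rewrite -gE; last exact: Linfty_indic.
  rewrite integral_mkcond [RHS]integral_mkcond; apply: eq_integral => x _.
  rewrite !patchE indicE; case: ifPn => [/set_mem Bx|]; last by rewrite mulr0; case: ifP.
  by rewrite mulr1 mem_set//; exact: BI.
apply: (@le_trans _ _ (c%:E * mu (I `&` S @^-1` B))%E).
  by rewrite EFinM -muleA lee_wpmul2l ?lee_fin//; exact: muI.
pose k (x : Rm) := (c * \1_(I `&` S @^-1` B) x)%:E.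
have -> : (c%:E * mu (I `&` S @^-1` B) = \int[mu]_(x in I01) k x)%E.
  rewrite /k; under eq_integral do rewrite EFinM.
  rewrite ge0_integralZl_EFin//; last exact/measurable_EFinP/measurable_indic.
  rewrite integral_indic////; congr (_ * mu _)%E.
  by apply/esym/setIidl => x [/II].
have mf := L1_measurable f1.
have mBS : measurable_fun I01 (\1_B \o S : Rm -> R).
  apply: (measurable_comp (F := setT)) => //; exact: measurable_indic.
(* Truncation at 0 changes [f] only on a null set and supplies the pointwise sign that the
   comparison of integrals asks for. *)
pose fp (x : Rm) := (Num.max (f x) 0 * \1_B (S x))%:E.
have mfp : measurable_fun I01 fp.
  apply/measurable_EFinP/measurable_funM => //.
  exact: measurable_maxr.
rewrite [leRHS](_ : _ = (\int[mu]_(x in I01) fp x)%E); last first.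
  apply: ae_eq_integral => //.
    by apply/measurable_EFinP/measurable_funM.
  by apply: lebesgue_aeS f0 => x fx Ix; rewrite /fp max_l// fx.
apply: ae_ge0_le_integral => //.
- by move=> x _; rewrite lee_fin mulr_ge0.
- by apply/measurable_EFinP/measurable_funM => //; exact: measurable_indic.
- by move=> x _; rewrite lee_fin mulr_ge0// le_max lexx orbT.
- apply: lebesgue_aeS fc => x fx Ix; rewrite lee_fin !indicE in_setI.
  rewrite -[x \in S @^-1` B]/(S x \in B).
  case: (boolP (x \in I)) => [/set_mem/fx cf|_] /=.
    by rewrite ler_wpM2r// le_max cf.
  by rewrite mulr0 mulr_ge0// le_max lexx orbT.
Qed.

End Duality.

(** * Iterated maps and iterated transfer operators *)

Section Compositions.
Context {R : realType}.
Local Notation mu := (@lebesgue_measure R).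
Implicit Types (T : nat -> pexp_map R) (f g h : R -> R) (I E : set R).

Lemma foldl_iotaSr {A : Type} (F : A -> nat -> A) z p n :
  foldl F z (index_iota p.+1 (p + n.+1).+1) =
  F (foldl F z (index_iota p.+1 (p + n).+1)) (p + n.+1)%N.
Proof.
by rewrite /index_iota !subSS !addKn -(addn1 n) iotaD foldl_cat/= addSnnS addn1.
Qed.

Lemma foldl_iota0 {A : Type} (F : A -> nat -> A) z p :
  foldl F z (index_iota p.+1 (p + 0).+1) = z.
Proof. by rewrite /index_iota subSS addKn. Qed.

Lemma seq_mapSr T p n x :
  seq_map T p.+1 (p + n.+1) x = T (p + n.+1)%N (seq_map T p.+1 (p + n) x).
Proof. exact: (@foldl_iotaSr R). Qed.

Lemma seq_map0 T p x : seq_map T p.+1 (p + 0) x = x.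
Proof. exact: (@foldl_iota0 R). Qed.

Lemma seq_mapSl T p k x : (p < k)%N ->
  seq_map T p.+1 k x = seq_map T p.+2 k (T p.+1 x).
Proof.
rewrite -subn_gt0 /seq_map /index_iota !subSS subnS.
by case: (k - p)%N.
Qed.

Lemma seq_map_stable T p n x : I01 x -> I01 (seq_map T p.+1 (p + n) x).
Proof.
move=> Ix; elim: n => [|n IH]; first by rewrite seq_map0.
by rewrite seq_mapSr; apply: pexp_stable; eexists; first exact: IH.
Qed.

Lemma measurable_seq_map T p n : measurable_fun I01 (seq_map T p.+1 (p + n)).
Proof.
elim: n => [|n IH].
  by apply: (eq_measurable_fun id) => // x _; rewrite seq_map0.
apply: (eq_measurable_fun (T (p + n.+1)%N \o seq_map T p.+1 (p + n))) => [x _|].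
  by rewrite seq_mapSr.
apply: (measurable_comp measurable_I01) IH; last exact: measurable_fun_pexp.
by move=> _ [x Ix <-]; exact: seq_map_stable.
Qed.

Lemma outer_seq_image T (K : R) p n E : 0 < K ->
  (forall j, (p < j)%N -> (sup_derivative (pexp_part (T j)) (T j) <= K%:E)%E) ->
  E `<=` I01 ->
  (outer (seq_map T p.+1 (p + n) @` E) <= (K ^+ n)%:E * outer E)%E.
Proof.
move=> K0 TK EI; elim: n => [|n IH].
  by rewrite expr0 mul1e (eq_imagel (fun x _ => seq_map0 T p x)) image_id.
rewrite (eq_imagel (fun x _ => seq_mapSr T p n x)).
rewrite -(image_comp (seq_map T p.+1 (p + n))) exprS.
apply: (le_trans (outer_image K0 _ _)).
- by apply: TK; rewrite addnS ltnS leq_addr.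
- by move=> _ [x /EI Ix <-]; exact: seq_map_stable.
- by rewrite EFinM -muleA lee_wpmul2l// lee_fin ltW.
Qed.

(** Duality and nonnegativity are proved in one induction, since [transferP] needs the sign of the
    previous iterate. *)
Lemma seq_transferP T p n f : in_L1 f -> {ae mu, forall x, I01 x -> 0 <= f x} ->
  transfers (seq_map T p.+1 (p + n)) f (seq_transfer T p.+1 (p + n) f) /\
  {ae mu, forall x, I01 x -> 0 <= seq_transfer T p.+1 (p + n) f x}.
Proof.
move=> f1 f0; elim: n => [|n [[g1 gE] g0]].
  rewrite /seq_transfer foldl_iota0; split=> //; split=> // h _.
  by under [RHS]eq_integral do rewrite seq_map0.
rewrite /seq_transfer foldl_iotaSr -/(seq_transfer T p.+1 (p + n) f).
set g := seq_transfer T p.+1 (p + n) f in g1 gE g0 *.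
have Pg := transferP (T (p + n.+1)%N) g1 g0.
split.
  split=> [|h hoo]; first exact: Pg.1.
  rewrite Pg.2// gE; last exact: Linfty_comp.
  by apply: eq_integral => x _; rewrite seq_mapSr.
(* Nonnegativity is the lower bound with both constants equal to 0. *)
have := @transfers_ge _ _ _ _ I01 0 0 (measurable_fun_pexp (T (p + n.+1)%N)) g1 Pg g0.
rewrite mulr0; apply => //; first exact: measurable_I01.
by move=> B _ _; rewrite mul0e.
Qed.

(** As [I] is mapped onto [I01], each [B] is covered by the image of the part of its preimage in
    [I]; that part has measure at least that of [B] divided by [K ^+ n]. *)
Lemma seq_transfer_ge T (K : R) p n f I (c : R) : 0 < K ->
  (forall j, (p < j)%N -> (sup_derivative (pexp_part (T j)) (T j) <= K%:E)%E) ->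
  in_L1 f -> {ae mu, forall x, I01 x -> 0 <= f x} ->
  measurable I -> I `<=` I01 -> 0 <= c -> {ae mu, forall x, I x -> c <= f x} ->
  seq_map T p.+1 (p + n) @` I = I01 ->
  {ae mu, forall x, I01 x -> c / K ^+ n <= seq_transfer T p.+1 (p + n) f x}.
Proof.
move=> K0 TK f1 f0 mI II c0 fc SI; have [Pf _] := seq_transferP T p n f1 f0.
apply: (transfers_ge (measurable_seq_map T p n) f1 Pf f0 mI II c0 fc).
move=> B mB BI; rewrite muleC lee_pdivrMr ?exprn_gt0// muleC.
apply: le_trans (outer_seq_image n K0 TK _); last by move=> x [/II].
apply: (le_outer_measure outer) => x Bx.
by have := BI _ Bx; rewrite -SI => -[y Iy yx]; exists y => //; split=> //=; rewrite yx.
Qed.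

End Compositions.

(** * Elements of the partitions of monotonicity *)

Section Cylinders.
Context {R : realType}.
Implicit Types (V W I : set R) (x y : R).

Lemma open_subitv V : open V -> V !=set0 ->
  exists a b : R, a < b /\ `[a, b]%classic `<=` V.
Proof.
move=> oV [x Vx]; have /nbhs_ballP[e /= e0 eV] := open_nbhs_nbhs (conj oV Vx).
exists x, (x + e / 2); split; first by rewrite ltrDl divr_gt0.
move=> y /=; rewrite in_itv/= => /andP[xy ye]; apply: eV => /=.
by rewrite /ball/= distrC ger0_norm ?subr_ge0//; lra.
Qed.

(** Otherwise every element meets a segment inside [V] in at most one point, and the segment would
    have measure 0. *)
Lemma part_meets_open (T : pexp_map R) V : open V -> V !=set0 -> V `<=` I01 ->
  exists2 J, pexp_part T J & V `&` J° !=set0.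
Proof.
move=> oV V0 VI; have [a [b [ab abV]]] := open_subitv oV V0.
have [F [FT FI _]] := part_enum T.
apply: contrapT => VJ.
have : (outer `[a, b]%classic <= 0)%E.
  have -> : `[a, b]%classic = \bigcup_i (`[a, b]%classic `&` F i).
    by rewrite -setI_bigcupr FI; apply/esym/setIidl => x /abV/VI.
  apply: (le_trans (outer_measure_sigma_subadditive _ _)).
  rewrite eseries0// => i _ _; apply/eqP; rewrite eq_le outer_measure_ge0 andbT.
  have [TJ|->] := FT i; last by rewrite setI0 outer_measure0.
  have iJ := part_interval TJ.
  have noxy x y : `[a, b]%classic x -> `[a, b]%classic y -> F i x -> F i y -> ~ x < y.
    move=> /= xab yab Fx Fy xy; apply: VJ; exists (F i) => //; exists ((x + y) / 2).
    split; last by apply: interval_interior iJ Fx Fy _ _; rewrite /= in_itv/=; lra.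
    by apply: abV; move: xab yab; rewrite /= !in_itv/=; lra.
  apply: outer_diam => // x y [xab Fx] [yab Fy].
  case: (ltgtP x y) => [/noxy|/noxy|->]; [by case|by case|by rewrite subrr normr0].
rewrite -[outer _]/(lebesgue_measure `[a, b]%classic) lebesgue_measure_itv/=.
by rewrite lte_fin ab -EFinB lee_fin; lra.
Qed.

(** Expansion separates the images of the ends of a segment in [W]; the intermediate value theorem
    fills the gap between them. *)
Lemma image_interior (T : pexp_map R) J W : pexp_part T J -> open W -> W !=set0 ->
  W `<=` J° -> (T @` W)° !=set0.
Proof.
move=> TJ oW W0 WJ; have [a [b [ab abW]]] := open_subitv oW W0.
have Tc : {within `[a, b], continuous T}.
  apply: continuous_in_subspaceT => x /set_mem /abW /WJ Jx.
  exact: part_continuous TJ Jx.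
have Wab x : x \in `[a, b] -> J x by move=> /abW/WJ; exact: interior_subset.
have TaTb : T a != T b.
  have := expanding_ge1 TJ (Wab a _) (Wab b _); rewrite !bound_itvE ltW//.
  move=> /(_ isT isT); apply: contraTneq => ->.
  by rewrite subrr normr0 normr_le0 subr_eq0 lt_eqF.
have itvT : `]Num.min (T a) (T b), Num.max (T a) (T b)[%classic `<=` T @` W.
  move=> v /=; rewrite in_itv/= => /andP[/ltW v1 /ltW v2].
  have [|c cab <-] := @IVT _ T a b v (ltW ab) Tc; first by rewrite v1 v2.
  by exists c => //; exact: abW.
exists ((T a + T b) / 2).
rewrite open_subsetE in itvT; last exact: interval_open.
apply: itvT; rewrite /= in_itv/=.
case: (ltgtP (T a) (T b)) TaTb => // lt_T _.
  by apply/andP; split; lra.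
by apply/andP; split; lra.
Qed.

(** Induction on [n]: choose a branch of the first map whose interior meets [V], apply the
    hypothesis to the interior of the image, and pull the resulting open set back through the
    branch. *)
Lemma exists_cylinder (T : nat -> pexp_map R) n p V :
  open V -> V !=set0 -> V `<=` I01 ->
  exists (J : nat -> set R) W,
    [/\ forall j, (p < j <= p + n)%N -> pexp_part (T j) (J j),
        open W, W !=set0, W `<=` V &
        forall x j, W x -> (p < j <= p + n)%N -> J j (seq_map T p.+1 j.-1 x)].
Proof.
elim: n p V => [|n IH] p V oV V0 VI.
  (* No index satisfies [p < j <= p + 0], so the choice of elements is arbitrary. *)
  exists (fun=> set0), V; split=> //.
    by move=> j /andP[pj]; rewrite addn0 leqNgt pj.
  by move=> x j _ /andP[pj]; rewrite addn0 leqNgt pj.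
have [J1 TJ1 V1] := part_meets_open (T p.+1) oV V0 VI.
have oJ1 : open (V `&` J1°) by apply: openI => //; exact: open_interior.
have := image_interior TJ1 oJ1 V1 (@subIsetr _ _ _).
set V2 := interior _ => V20.
have V2W : V2 `<=` T p.+1 @` (V `&` J1°) by exact: interior_subset.
have V2I : V2 `<=` I01.
  by move=> y /V2W[x [/VI Ix _] <-]; apply: pexp_stable; exists x.
have [J' [W' [TJ' oW' [y W'y] W'V JW']]] := IH p.+1 V2 (open_interior _) V20 V2I.
exists (fun j => if j == p.+1 then J1 else J' j).
exists (V `&` J1° `&` T p.+1 @^-1` W'); split.
- move=> j /andP[pj jn]; case: eqVneq => [->//|jp].
  by apply: TJ'; rewrite addSnnS jn andbT ltn_neqAle eq_sym jp.
- rewrite openE => x [[Vx J1x] W'x]; apply: filterI.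
    exact: open_nbhs_nbhs.
  by apply: (part_continuous TJ1 J1x); exact: open_nbhs_nbhs.
- have [x Vx Tx] := V2W _ (W'V _ W'y); exists x; split => //=.
  by rewrite Tx.
- by move=> x [[]].
- move=> x j [[Vx J1x] W'x] /andP[pj jn]; case: eqVneq => [->|jp].
    by rewrite /= -[p in seq_map _ _ p _]addn0 seq_map0; exact: interior_subset.
  have pj' : (p.+1 < j)%N by rewrite ltn_neqAle eq_sym jp.
  rewrite seq_mapSl; last by rewrite -ltnS prednK// (leq_ltn_trans _ pj).
  by apply: JW' => //; rewrite addSnnS jn andbT.
Qed.

(** The open set [W] both meets [V] and certifies the nonempty interior required by
    [seq_partition]. *)
Lemma seq_partition_meets (T : nat -> pexp_map R) p n V :
  open V -> V !=set0 -> V `<=` I01 ->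
  exists2 I, seq_partition T p.+1 (p + n) I & I `&` V !=set0.
Proof.
move=> oV V0 VI; have [J [W [TJ oW [x Wx] WV WJ]]] := exists_cylinder T n p oV V0 VI.
pose I := I01 `&` \bigcap_(j in [set j | (p.+1 <= j <= p + n)%N])
  (seq_map T p.+1 j.-1 @^-1` J j).
have WI : W `<=` I by move=> y Wy; split=> [|j pj]; [exact/VI/WV|exact: WJ].
exists I; last by exists x; split; [exact: WI|exact: WV].
split; last by exists J.
by exists x; rewrite open_subsetE in WI => //; exact: WI.
Qed.

Lemma seq_partition_sub (T : nat -> pexp_map R) n k I : seq_partition T n k I ->
  I `<=` I01.
Proof. by move=> [_ [J [_ ->]]]; exact: subIsetl. Qed.

Lemma seq_partition_measurable (T : nat -> pexp_map R) p k I :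
  seq_partition T p.+1 k I -> measurable I.
Proof.
move=> [_ [J [TJ ->]]].
set D := [set j | _].
(* The iterates are known to be measurable on [I01] only; adding its complement to each factor makes
   the factor measurable and leaves the intersection unchanged. *)
have -> : I01 `&` \bigcap_(j in D) (seq_map T p.+1 j.-1 @^-1` J j) =
    I01 `&` \bigcap_(j in D) ((I01 `&` seq_map T p.+1 j.-1 @^-1` J j) `|` ~` I01).
  apply/seteqP; split=> x [Ix Jx]; split=> // j Dj; first by left; split=> //; exact: Jx.
  by have [[]|] := Jx j Dj.
have mI := @measurable_I01 R.
apply: measurableI => //; apply: bigcap_measurableType => j Dj.
apply: measurableU; last exact: measurableC.
have /andP[pj _] := Dj.
have -> : j.-1 = (p + (j.-1 - p))%N by rewrite subnKC// -ltnS (ltn_predK pj).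
apply: measurable_seq_map => //; apply: is_interval_measurable.
exact: part_interval (TJ _ Dj).
Qed.

(** Two points of [I] follow the same branches, so each step multiplies their distance by at least
    [lam], while their images stay within distance 1. *)
Lemma seq_partition_diam (T : nat -> pexp_map R) (lam : R) p n I : 0 < lam ->
  (forall j, (p < j)%N -> (lam%:E <= inf_derivative (pexp_part (T j)) (T j))%E) ->
  seq_partition T p.+1 (p + n) I ->
  forall x y, I x -> I y -> `|x - y| <= lam ^- n.
Proof.
move=> lam0 Tlam [_ [J [TJ ->]]] x y [Ix Jx] [Iy Jy].
have : forall i, (i <= n)%N ->
    lam ^+ i * `|x - y| <= `|seq_map T p.+1 (p + i) x - seq_map T p.+1 (p + i) y|.
  elim=> [|i IH] ni; first by rewrite !seq_map0 mul1r.
  rewrite !seq_mapSr exprS -mulrA.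
  have pi : (p < p + i.+1 <= p + n)%N by rewrite leq_add2l ni addnS ltnS leq_addr.
  apply: le_trans (part_expand (Tlam _ _) (TJ _ pi) _ _).
  - by rewrite ler_wpM2l ?(ltW lam0)// IH// ltnW.
  - by rewrite addnS ltnS leq_addr.
  - by have := Jx _ pi; rewrite /= addnS.
  - by have := Jy _ pi; rewrite /= addnS.
move=> /(_ n (leqnn n)) H.
rewrite -[leRHS]mul1r ler_pdivlMr ?exprn_gt0// mulrC (le_trans H)//.
have := seq_map_stable T p n Ix; have := seq_map_stable T p n Iy.
by rewrite /I01/= !in_itv/= ler_norml; lra.
Qed.

End Cylinders.

(** * Uniform lower bounds *)

Section GoodCell.
Context {R : realType}.
Local Notation mu := (@lebesgue_measure R).
Local Notation Rm := (measurableTypeR R).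
Implicit Types (f g : R -> R) (a b c x y : R).

Lemma total_variation_ge_itv a b g x y : x \in `[a, b] -> y \in `[a, b] ->
  (`|g x - g y|%:E <= total_variation a b g)%E.
Proof.
wlog xy : x y / x <= y.
  by move=> H xab yab; have [?|/ltW ?] := leP x y; [|rewrite distrC]; exact: H.
rewrite !in_itv/= => /andP[ax xb] /andP[ay yb].
rewrite (total_variationD _ ax xb) (total_variationD _ xy yb) distrC.
apply: (le_trans (total_variation_ge _ xy)).
apply: (@le_trans _ _ (total_variation x y g + total_variation y b g)%E).
  by rewrite leeDl// total_variation_ge0.
by rewrite leeDr// total_variation_ge0.
Qed.

Lemma integral_le_cst (A : set R) f c : measurable A -> A `<=` I01 -> in_L1 f ->
  {ae mu, forall x, A x -> f x <= c} ->
  (\int[mu]_(x in A) (f x)%:E <= c%:E * mu A)%E.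
Proof.
move=> mA AI f1 fc.
have mA' : measurable (A : set Rm) by [].
have mf : measurable_fun A f.
  by apply: measurable_funS (L1_measurable f1) => //; exact: measurable_I01.
have fA : mu.-integrable A (EFin \o f).
  by apply: integrableS f1 => //; exact: measurable_I01.
have muA : (mu A < +oo)%E.
  apply: (@le_lt_trans _ _ (mu I01)); last by rewrite lebesgue_measure_I01 ltry.
  by apply: le_measure; rewrite ?inE//; exact: measurable_I01.
have cA : mu.-integrable A (EFin \o cst c).
  by apply: measurable_bounded_integrable => //; exact: bounded_cst.
have mcf : measurable_fun A (fun x => c - f x) by apply: measurable_funB.
have : (0 <= \int[mu]_(x in A) (c%:E - (f x)%:E))%E.
  (* The bound holds only almost everywhere; truncation gives an integrand that is nonnegative at
     every point. *)
  have -> : (\int[mu]_(x in A) (c%:E - (f x)%:E) =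
      \int[mu]_(x in A) (Num.max (c - f x) 0)%:E)%E.
    apply: ae_eq_integral => //.
    - by under eq_fun do rewrite -EFinB; exact/measurable_EFinP.
    - by apply/measurable_EFinP; exact: measurable_maxr.
    - by apply: lebesgue_aeS fc => x fx /fx fxc; rewrite max_l ?EFinB// subr_ge0.
  by apply: integral_ge0 => x _; rewrite lee_fin le_max lexx orbT.
rewrite integralB// integral_cst// sube_ge0//.
by rewrite integrable_fin_num.
Qed.

Lemma good_cell f (B : R) (M : nat) : in_L1 f ->
  (\int[mu]_(x in I01) (f x)%:E = 1)%E -> (var f < B%:E)%E ->
  (0 < M)%N -> 2 * B <= M%:R ->
  exists a, [/\ 0 <= a, a + M%:R^-1 <= 1 &
    {ae mu, forall x, x \in `[a, a + M%:R^-1] -> 1 / 2 <= f x}].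
Proof.
(* The strict bound on [var f] provides an actual representative [g] of variation below [B]. *)
move=> f1 int1 /ereal_inf_lt[_ [g gf <-] gB] M0 BM.
set h := M%:R^-1; have h0 : 0 < h by rewrite invr_gt0 ltr0n.
have Mh : M%:R * h = 1 by rewrite divff// pnatr_eq0 -lt0n.
apply: contrapT => noa.
have cell k : (k < M)%N -> exists2 x, x \in `[k%:R * h, k.+1%:R * h] & g x < 1 / 2.
  move=> kM; apply: contrapT => nox; apply: noa; exists (k%:R * h).
  have kh : k%:R * h + h = k.+1%:R * h by rewrite -natr1 mulrDl mul1r.
  rewrite kh; split.
  - by rewrite mulr_ge0// ltW.
  - by rewrite -[leRHS]Mh ler_wpM2r ?ler_nat// ?(ltW h0).
  - apply: lebesgue_aeS gf => x fx xk; rewrite -fx.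
      by rewrite leNgt; apply/negP => gx; apply: nox; exists x.
    rewrite /I01/= in_itv/=; move: xk; rewrite in_itv/= => /andP[k1 k2].
    rewrite (le_trans _ k1) ?mulr_ge0 ?(ltW h0)//= (le_trans k2)//.
    by rewrite -[leRHS]Mh ler_wpM2r ?ler_nat// ?(ltW h0).
pose A (k : nat) : set R := `[0, k%:R * h]%classic.
(* The cell estimates are summed from the left, using additivity of the variation over adjacent
   intervals. *)
have claim k : (k <= M)%N ->
    (\int[mu]_(x in A k) (f x)%:E <=
     (k%:R * h / 2)%R%:E + h%:E * total_variation 0 (k%:R * h)%R g)%E.
  elim: k => [|k IH] kM.
    rewrite /A !mul0r total_variationxx mule0 set_itv1 integral_set1.
    by rewrite adde0.
  pose a := k%:R * h; pose b := k.+1%:R * h.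
  have ab : b - a = h by rewrite /a /b -natr1 mulrDl mul1r addrAC subrr add0r.
  have a0 : 0 <= a by rewrite mulr_ge0// ltW.
  have b1 : b <= 1 by rewrite -[leRHS]Mh ler_wpM2r ?ler_nat// ltW.
  have lab : a < b by rewrite -subr_gt0 ab.
  have TVab : (total_variation a b g \is a fin_num).
    rewrite ge0_fin_numE; last exact/total_variation_ge0/ltW.
    apply: (le_lt_trans _ (lt_trans gB (ltry B))).
    rewrite (total_variationD _ a0 (le_trans (ltW lab) b1)).
    rewrite (total_variationD _ (ltW lab) b1) addeCA leeDl//.
    by rewrite adde_ge0 ?total_variation_ge0// ltW.
  have mab : measurable (`]a, b]%classic : set Rm) by exact: measurable_itv.
  have mAk : measurable (A k : set Rm) by exact: measurable_itv.
  have AE : A k.+1 = A k `|` `]a, b]%classic.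
    apply/seteqP; split=> x; rewrite /A /= !in_itv/= -/a -/b => H.
      by have [xa|xa] := leP x a; [left|right]; lra.
    by case: H => H; lra.
  have abI : `]a, b]%classic `<=` I01 by move=> x; rewrite /I01/= !in_itv/=; lra.
  have AI : A k `<=` I01 by move=> x; rewrite /A /I01/= !in_itv/= -/a; lra.
  rewrite AE integral_setU//; last 2 first.
  - apply/measurable_EFinP; apply: measurable_funS (L1_measurable f1).
      exact: measurable_I01.
    by move=> x [/AI|/abI].
  - rewrite disj_set2E; apply/eqP/seteqP; split=> // x [].
    by rewrite /A /= !in_itv/= -/a; lra.
  have [y yab gy] := cell k kM.
  have f_le : {ae mu, forall x, `]a, b]%classic x ->
      f x <= 2^-1 + fine (total_variation a b g)}.
    apply: lebesgue_aeS gf => x fx xab; rewrite -fx; last exact: abI.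
    have xab' : x \in `[a, b] by apply: subset_itv_oc_cc xab.
    have := total_variation_ge_itv g xab' yab.
    by rewrite -(fineK TVab) lee_fin ler_norml; lra.
  apply: (le_trans (leeD (IH (ltnW kM)) (integral_le_cst mab abI f1 f_le))).
  rewrite (total_variationD _ a0 (ltW lab)) -(fineK TVab).
  rewrite ge0_muleDr ?lee_fin ?fine_ge0 ?total_variation_ge0// ?(ltW lab)//.
  rewrite lebesgue_measure_itv/= lte_fin lab -EFinB ab -!EFinM.
  rewrite addeAC [leRHS]addeCA [leRHS]addeC -EFinD.
  by apply: leeD2r; rewrite -EFinD lee_fin -natr1; lra.
(* For [k = M] the claim bounds the integral, which is 1, by [1/2] plus [h] times a variation below
   [B]; since [2 * B <= M], that is less than 1. *)
have := claim M (leqnn M); rewrite /A Mh int1 leNgt => /negP; apply.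
have -> : (1%:E = 2^-1%:E + h%:E * (M%:R / 2)%R%:E :> \bar R)%E.
  by rewrite -EFinM -EFinD mulrA (mulrC h) Mh; congr EFin; lra.
rewrite mul1r lteD2lE//.
apply: (@lt_le_trans _ _ (h%:E * B%:E)%E).
  by rewrite lte_pmul2l.
by rewrite -!EFinM lee_fin ler_pM2l//; lra.
Qed.

End GoodCell.

(** * Bounds on the variation that are uniform in time *)

Section UniformBounds.
Context {R : realType}.
Local Notation mu := (@lebesgue_measure R).
Implicit Types (T : nat -> pexp_map R) (f : R -> R).

Lemma seq_transfer_cat T p n f :
  seq_transfer T 1 (p + n) f = seq_transfer T p.+1 (p + n) (seq_transfer T 1 p f).
Proof.
elim: n => [|n IH]; rewrite /seq_transfer; first by rewrite foldl_iota0 addn0.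
rewrite foldl_iotaSr addnS (foldl_iotaSr _ _ 0) -addnS.
by congr transfer; rewrite addnS; exact: IH.
Qed.

(** [cond_D] speaks of maps indexed from 1, so later blocks have to be reindexed. *)
Lemma seq_transfer_shift T p n f :
  seq_transfer T p.+1 (p + n) f = seq_transfer (fun i => T (p + i)%N) 1 n f.
Proof.
elim: n => [|n IH]; rewrite /seq_transfer; first by rewrite foldl_iota0.
rewrite foldl_iotaSr (foldl_iotaSr _ _ 0)/= add0n; congr transfer; exact: IH.
Qed.

Lemma bounded_affine_recurrence (a : nat -> R) r (rho c : R) : (0 < r)%N ->
  (forall n, 0 <= a n) -> 0 < rho < 1 -> 0 < c ->
  (forall n, a (n + r)%N <= rho * a n + c) -> exists B, forall n, a n <= B.
Proof.
move=> r0 a0 /andP[rho0 rho1] c0 ar.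
have s0 : 0 <= \sum_(i < r) a i by exact: sumr_ge0.
have rho1' : 0 < 1 - rho by lra.
(* The sum dominates the [r] initial terms; the second summand ensures [rho * B + c <= B]. *)
pose B := \sum_(i < r) a i + c / (1 - rho); exists B.
have cB : c <= (1 - rho) * B.
  rewrite /B mulrDr (mulrC _ (c / _)) divfK ?gt_eqF// lerDr.
  by apply: mulr_ge0 => //; exact: ltW.
elim/ltn_ind => n IH; have [nr|rn] := ltnP n r.
  rewrite /B (bigD1 (Ordinal nr))//= -addrA lerDl addr_ge0 ?sumr_ge0//.
  by rewrite divr_ge0// ltW.
rewrite -(subnK rn); apply: (le_trans (ar _)).
have : rho * a (n - r)%N <= rho * B.
  apply: ler_wpM2l; first exact: ltW.
  by apply: IH; rewrite ltn_subrL r0 (leq_trans r0).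
lra.
Qed.

Lemma cst1_L1 : in_L1 (cst 1 : R -> R).
Proof.
have mu_fin : (mu I01 < +oo)%E by rewrite lebesgue_measure_I01 ltry.
apply: (@measurable_bounded_integrable _ _ _ mu).
- exact: measurable_I01.
- exact: mu_fin.
- exact: measurable_cst.
- exact: bounded_cst.
Qed.

Lemma cst1_ge0 : {ae mu, forall x, I01 x -> 0 <= (cst 1 : R -> R) x}.
Proof. by apply: aeW => x _; exact: ler01. Qed.

Lemma var_ge0 f : (0 <= var f)%E.
Proof.
by apply: le_ereal_inf_tmp => _ [g _ <-]; exact: total_variation_ge0.
Qed.

Lemma var_cst1 : (var (cst 1%R : R -> R) <= 0)%E.
Proof.
apply: ereal_inf_lbound; exists (cst 1); first by apply: aeW.
by rewrite nondecreasing_total_variation// subrr.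
Qed.

Lemma integral_seq_transfer T n :
  (\int[mu]_(x in I01) (seq_transfer T 1 n (cst 1%R) x)%:E = 1)%E.
Proof.
have [[_ /(_ (cst 1)) H] _] := seq_transferP T 0 n cst1_L1 cst1_ge0.
have /H : in_Linfty (cst 1 : R -> R).
  split; first exact: measurable_cst.
  by exists 1; apply: aeW => x _; rewrite normr1.
under eq_integral do rewrite mulr1.
under [RHS]eq_integral do rewrite mulr1.
rewrite add0n => ->; rewrite -[LHS]/(\int[mu]_(x in I01) cst 1%:E x)%E.
rewrite integral_cst; last exact: measurable_I01.
by rewrite mul1e; exact: lebesgue_measure_I01.
Qed.

Lemma L1norm_seq_transfer T n : L1norm (seq_transfer T 1 n (cst 1)) = 1%E.
Proof.
have [[F1 _] F0] := seq_transferP T 0 n cst1_L1 cst1_ge0.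
rewrite -(integral_seq_transfer T n) /L1norm.
have mF := L1_measurable F1.
apply: ae_eq_integral => //.
- exact: measurable_I01.
- apply/measurable_EFinP; exact: (measurableT_comp (@normr_measurable _ setT) mF).
- exact/measurable_EFinP.
- by apply: lebesgue_aeS F0 => x Fx /Fx ?; rewrite ger0_norm.
Qed.

Lemma var_seq_transfer_bounded (C : set (pexp_map R)) r T : (1 <= r)%N ->
  cond_D r C -> (forall n, (1 <= n)%N -> C (T n)) ->
  exists B : R, forall n, (var (seq_transfer T 1 n (cst 1%R)) < B%:E)%E.
Proof.
move=> r1 [rho [M0 [Cr [rho01 M00 Cr0 DM Dr]]]] CT.
pose F n := seq_transfer T 1 n (cst 1).
have F1 n : in_L1 (F n) by have [[]] := seq_transferP T 0 n cst1_L1 cst1_ge0.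
have normF n : (BVnorm (F n) = var (F n) + 1)%E by rewrite /BVnorm L1norm_seq_transfer.
(* The one-step bound keeps each variation finite, so that the recurrence can be written in the
   reals. *)
have FBV n : in_BV (F n).
  elim: n => [|n IH].
    split; first exact: F1.
    by rewrite /F /seq_transfer (foldl_iota0 _ _ 0) (le_lt_trans var_cst1)// ltry.
  split; first exact: F1.
  have := DM (T n.+1) (F n) (CT n.+1 isT) IH.
  have <- : F n.+1 = transfer (T n.+1) (F n) by rewrite /F /seq_transfer (foldl_iotaSr _ _ 0).
  rewrite !normF => H; rewrite -(lteD2rE _ _ (erefl : 1%:E \is a fin_num)).
  apply: (le_lt_trans H).
  have /fineK <- : var (F n) \is a fin_num by rewrite ge0_fin_numE ?var_ge0//; exact: IH.2.
  by rewrite -EFinD -EFinM addye// ltry.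
pose a n := fine (var (F n)).
have aE n : var (F n) = (a n)%:E.
  by rewrite /a fineK// ge0_fin_numE ?var_ge0//; exact: (FBV n).2.
(* [a n + 1] is the BV norm of [F n], whose L1 norm is 1; $(D_r)$ is applied to the [r] maps
   following time [n]. *)
have [B aB] : exists B, forall n, a n + 1 <= B.
  apply: (@bounded_affine_recurrence (fun n => a n + 1) r rho Cr) => //.
    by move=> n; rewrite addr_ge0// fine_ge0// var_ge0.
  move=> n; have := Dr (fun i => T (n + i)%N) (F n) _ (FBV n).
  rewrite -seq_transfer_shift -seq_transfer_cat -/(F _) !normF !aE.
  rewrite L1norm_seq_transfer mule1 -!EFinD lee_fin; apply.
  by move=> i /andP[i1 _]; apply: CT; rewrite addn_gt0 i1 orbT.
by exists B => n; rewrite aE lte_fin (lt_le_trans _ (aB n))// ltrDl.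
Qed.

End UniformBounds.

Lemma expr_unbounded {R : realType} (lam b : R) : 1 < lam ->
  exists n, b <= lam ^+ n.
Proof.
(* Bernoulli's inequality reduces the claim to the Archimedean property. *)
move=> lam1.
have bern n : 1 + n%:R * (lam - 1) <= lam ^+ n.
  elim: n => [|n IH]; first by rewrite mul0r addr0 expr0.
  rewrite exprS; apply: (@le_trans _ _ (lam * (1 + n%:R * (lam - 1)))).
    have : 0 <= n%:R * ((lam - 1) * (lam - 1)) by rewrite !mulr_ge0//; lra.
    by rewrite -natr1; lra.
  by rewrite ler_wpM2l//; lra.
have d0 : 0 < lam - 1 by lra.
exists (Num.bound `|b / (lam - 1)|); apply: le_trans (bern _).
have := le_lt_trans (ler_norm _) (archi_boundP (normr_ge0 (b / (lam - 1)))).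
by rewrite ltr_pdivrMr//; lra.
Qed.

Lemma seq_map_surjective {R : realType} (T : nat -> pexp_map R) p n :
  (forall j, (p < j)%N -> T j @` I01 = I01) ->
  seq_map T p.+1 (p + n) @` I01 = I01.
Proof.
move=> surj; elim: n => [|n IH].
  by rewrite (eq_imagel (fun x _ => seq_map0 T p x)) image_id.
rewrite (eq_imagel (fun x _ => seq_mapSr T p n x)).
rewrite -(image_comp (seq_map T p.+1 (p + n))) IH surj//.
by rewrite addnS ltnS leq_addr.
Qed.

Theorem proposition2 (R : realType) (C : set (pexp_map R)) (r : nat)
    (hr : (1 <= r)%N)
    (hsurj : forall S : pexp_map R, C S -> S @` I01 = I01)
    (hD : cond_D r C)
    (hderiv : exists lambda K : R, [/\ 1 < lambda, 0 < K &
      forall S : pexp_map R, C S ->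
        (lambda%:E <= inf_derivative (pexp_part S) S)%E /\
        (sup_derivative (pexp_part S) S <= K%:E)%E])
    (T : nat -> pexp_map R)
    (hT : forall n : nat, (1 <= n)%N -> C (T n))
    (hcov : covering T) :
  cond_Min T.
Proof.
have [lam [K0 [lam1 _ CK0]]] := hderiv.
(* With [K] at least 1, the powers [K ^- k] decrease, so the bound at time [N] also serves all
   earlier times. *)
pose K := Num.max K0 1.
have K1 : 1 <= K by rewrite le_max lexx orbT.
have Kpos : 0 < K by lra.
have TK p j : (p < j)%N -> (sup_derivative (pexp_part (T j)) (T j) <= K%:E)%E.
  move=> pj; have [_ /le_trans] := CK0 _ (hT j (leq_ltn_trans (leq0n p) pj)).
  by apply; rewrite lee_fin le_max lexx.
have Tlam p j : (p < j)%N -> (lam%:E <= inf_derivative (pexp_part (T j)) (T j))%E.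
  by move=> pj; have [] := CK0 _ (hT j (leq_ltn_trans (leq0n p) pj)).
have [B varB] := var_seq_transfer_bounded hr hD hT.
pose M := (Num.bound `|2 * B|).+1.
have M0 : (0 < M)%N by [].
have BM : 2 * B <= M%:R.
  apply: le_trans (ler_norm _) _; apply/ltW/(lt_trans (archi_boundP _)) => //.
  by rewrite ltr_nat.
pose h : R := M%:R^-1; have h0 : 0 < h by rewrite invr_gt0 ltr0n.
(* The diameters are to be at most a third of a cell; [n.+1] is used afterwards because [covering]
   requires a positive length. *)
have [n lamn] := expr_unbounded (3 / h) lam1.
have [N covN] := hcov n.+1 isT.
have diam_le : lam ^- n.+1 <= h / 3.
  rewrite -[leRHS]invrK invf_div lef_pV2 ?posrE ?exprn_gt0 ?divr_gt0//; try lra.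
  by apply: (le_trans lamn); rewrite ler_eXn2l.
exists (1 / 2 / K ^+ N); first by rewrite divr_gt0// exprn_gt0.
move=> k _; have [kN|Nk] := ltnP k N.
  (* Before time [N] the whole of [I01] plays the part of the covering element, with initial bound
     1. *)
  have surjT : seq_map T 1 (0 + k) @` I01 = I01.
    by apply: seq_map_surjective => j j0; exact/hsurj/hT.
  have := seq_transfer_ge Kpos (TK 0%N) cst1_L1 cst1_ge0 measurable_I01
    (fun x Ix => Ix) ler01 (aeW _ (fun x _ => lexx 1)) surjT.
  apply: lebesgue_aeS => x kx /kx; apply: le_trans.
  have half_le1 : 1 / 2 <= 1 :> R by lra.
  apply: ler_pM half_le1 _ => //; first by rewrite invr_ge0 exprn_ge0// ltW.
  by rewrite lef_pV2 ?posrE ?exprn_gt0// ler_weXn2l// ltnW.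
pose m := (k - N)%N; have -> : k = (m + N)%N by rewrite subnK.
have [[F1 _] F0] := seq_transferP T 0 m cst1_L1 cst1_ge0.
have [a [a0 a1 Fa]] := good_cell F1 (integral_seq_transfer T m) (varB m) M0 BM.
(* The middle third of the good cell: a set of diameter at most [h / 3] that meets it stays in the
   cell. *)
pose V : set R := `]a + h / 3, a + 2 * h / 3[%classic.
have oV : open V by exact: interval_open.
have V0 : V !=set0 by exists (a + h / 2); rewrite /V/= in_itv/=; apply/andP; split; lra.
have VI : V `<=` I01 by move=> x; rewrite /V /I01/= !in_itv/= -/h in a1 *; lra.
have [I TI [x0 [Ix0 Vx0]]] := seq_partition_meets T m n.+1 oV V0 VI.
rewrite seq_transfer_cat.
have half_ge0 : 0 <= 1 / 2 :> R by lra.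
apply: (seq_transfer_ge Kpos (TK m) F1 F0 (seq_partition_measurable TI)
  (seq_partition_sub TI) half_ge0 _ (covN _ _ TI)).
apply: lebesgue_aeS Fa => x Fx Ix; apply: Fx.
have := (fun lam0 => seq_partition_diam lam0 (Tlam m) TI Ix Ix0).
have Vx0' : a + h / 3 < x0 < a + 2 * h / 3 by move: Vx0; rewrite /V/= in_itv.
have lam0 : 0 < lam by lra.
move=> /(_ lam0) dx; have := le_trans dx diam_le.
rewrite ler_norml in_itv/= -/h => H; apply/andP; split; lra.
Qed.
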